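(* Let $\mathfrak g_{d}$ be an $n$-dyon and $\mathfrak g_{t}$ an $n$-triadon on the same $n$-dimensional vector space $V$, with centers $C_{d},C_{t}$, and put $C_{12}=C_{d}\cap C_{t}$. If $\dim C_{12}=n-2$, then $\mathfrak g_{d}$ and $\mathfrak g_{t}$ are compatible.
   Context: The ground field $\mathbf k$ has characteristic zero. An $n$-dyon is a Lie algebra structure on an $n$-dimensional vector space isomorphic to the direct sum of the non-abelian $2$-dimensional Lie algebra and the $(n-2)$-dimensional abelian Lie algebra. An $n$-triadon is one isomorphic to the direct sum of the $3$-dimensional Heisenberg algebra ($[\varepsilon_1,\varepsilon_2]=\varepsilon_3$, $\varepsilon_3$ central) and the $(n-3)$-dimensional abelian Lie algebra. Two Lie algebra structures on $V$ are compatible if the sum of their brackets is a Lie bracket. *)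

(* Defs.v *)
From HB Require Import structures.
From mathcomp Require Import all_boot all_order all_algebra.
From mathcomp Require Import ring.

Set Implicit Arguments.
Unset Strict Implicit.
Unset Printing Implicit Defensive.

Import GRing.Theory.
Local Open Scope ring_scope.

Definition is_lie_bracket (k : fieldType) (V : vectType k)
    (b : V -> V -> V) : Prop :=
  [/\ forall y, linear (b^~ y),
      forall x, linear (b x),
      forall x, b x x = 0
    & forall x y z, b x (b y z) + b y (b z x) + b z (b x y) = 0].

Record lie_structure (k : fieldType) (V : vectType k) := LieStructure {
  bracket :> V -> V -> V;
  bracketP : is_lie_bracket bracket
}.

Definition lie_iso (k : fieldType) (V W : vectType k)
    (g : lie_structure V) (h : lie_structure W) : Prop :=
  exists2 f : {linear V -> W},
    bijective f & forall x y, f (g x y) = h (f x) (f y).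

Section Center.
Variables (k : fieldType) (V : vectType k) (g : lie_structure V).

Definition adjoint (x : V) : 'End(V) := linfun (g x).

(* The center is the kernel of the adjoint map; see mem_center. *)
Definition center : {vspace V} := lker (linfun adjoint).

Lemma adjointE x y : adjoint x y = g x y.
Proof.
have [_ lr _ _] := bracketP g.
pose m := GRing.isLinear.Build _ _ _ _ (g x) (lr x).
pose f : {linear V -> V} := HB.pack (bracket g x) m.
exact: (lfunE f).
Qed.

Lemma adjoint_linear : linear adjoint.
Proof.
have [ll _ _ _] := bracketP g.
move=> a x y; apply/lfunP => z.
by rewrite add_lfunE scale_lfunE !adjointE ll.
Qed.

Lemma mem_center x : reflect (forall y, g x y = 0) (x \in center).
Proof.
pose m := GRing.isLinear.Build _ _ _ _ adjoint adjoint_linear.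
pose f : {linear V -> 'End(V)} := HB.pack adjoint m.
rewrite memv_ker (lfunE f); apply: (iffP eqP) => [fx0 y | gx0].
  by rewrite -adjointE -[adjoint x]/(f x) fx0 zero_lfunE.
by apply/lfunP => y; rewrite zero_lfunE adjointE.
Qed.

End Center.

Definition compatible (k : fieldType) (V : vectType k)
    (g h : lie_structure V) : Prop :=
  is_lie_bracket (fun x y => g x y + h x y).

Section DirectSum.
Variables (k : fieldType) (V W : vectType k).
Variables (g : lie_structure V) (h : lie_structure W).

Definition sum_bracket (x y : V * W) : V * W := (g x.1 y.1, h x.2 y.2).

Lemma sum_bracketP : is_lie_bracket sum_bracket.
Proof.
have [gl gr g0 gJ] := bracketP g; have [hl hr h0 hJ] := bracketP h.
split=> [y a u v | x a u v | x | x y z]; rewrite /sum_bracket /=.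
- by rewrite gl hl.
- by rewrite gr hr.
- by rewrite g0 h0.
- by apply: (congr2 pair (gJ _ _ _) (hJ _ _ _)).
Qed.

Definition lie_sum : lie_structure (V * W)%type := LieStructure sum_bracketP.

End DirectSum.

Section Models.
Variable k : fieldType.

Lemma abelian_bracketP (V : vectType k) :
  is_lie_bracket (fun _ _ : V => 0).
Proof. by split=> [? ? ? ?|? ? ? ?||] *; rewrite ?scaler0 ?addr0. Qed.

Definition lie_abelian (V : vectType k) : lie_structure V :=
  LieStructure (abelian_bracketP V).

(* [e_0, e_1] = e_1: up to isomorphism, the only non-abelian Lie algebra of
   dimension 2. *)
Definition nonabelian2_bracket (x y : 'rV[k]_2) : 'rV[k]_2 :=
  (x 0 0 * y 0 1 - x 0 1 * y 0 0) *: delta_mx 0 1.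

Lemma nonabelian2_bracketP : is_lie_bracket nonabelian2_bracket.
Proof.
split=> [y a u v | x a u v | x | x y z]; rewrite /nonabelian2_bracket.
- by rewrite !mxE scalerA -scalerDl; congr (_ *: _); ring.
- by rewrite !mxE scalerA -scalerDl; congr (_ *: _); ring.
- by rewrite mulrC subrr scale0r.
- rewrite !mxE /= -!scalerDl -[RHS](scale0r (delta_mx 0 1)).
  by congr (_ *: _); ring.
Qed.

Definition lie_nonabelian2 : lie_structure 'rV[k]_2 :=
  LieStructure nonabelian2_bracketP.

(* [e_0, e_1] = e_2, with e_2 central. *)
Definition heisenberg_bracket (x y : 'rV[k]_3) : 'rV[k]_3 :=
  (x 0 0 * y 0 1 - x 0 1 * y 0 0) *: delta_mx 0 2.

Lemma heisenberg_bracketP : is_lie_bracket heisenberg_bracket.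
Proof.
split=> [y a u v | x a u v | x | x y z]; rewrite /heisenberg_bracket.
- by rewrite !mxE scalerA -scalerDl; congr (_ *: _); ring.
- by rewrite !mxE scalerA -scalerDl; congr (_ *: _); ring.
- by rewrite mulrC subrr scale0r.
- rewrite !mxE /= -!scalerDl -[RHS](scale0r (delta_mx 0 2)).
  by congr (_ *: _); ring.
Qed.

Definition lie_heisenberg : lie_structure 'rV[k]_3 :=
  LieStructure heisenberg_bracketP.

End Models.

(* The condition on \dim makes the truncated subtractions below harmless: it
   forces 2 <= n for a dyon and 3 <= n for a triadon. *)
Definition is_dyon (n : nat) (k : fieldType) (V : vectType k)
    (g : lie_structure V) : Prop :=
  \dim {:V} = n /\
  lie_iso g (lie_sum (lie_nonabelian2 k) (lie_abelian 'rV[k]_(n - 2))).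

Definition is_triadon (n : nat) (k : fieldType) (V : vectType k)
    (g : lie_structure V) : Prop :=
  \dim {:V} = n /\
  lie_iso g (lie_sum (lie_heisenberg k) (lie_abelian 'rV[k]_(n - 3))).

(* Main.v *)
Require Import Defs.
From mathcomp Require Import all_boot all_order all_algebra.
From mathcomp Require Import ring.
Import GRing.Theory.
Local Open Scope ring_scope.

(** A bilinear alternating product [b] on [V] that is killed by a subspace [C]
    of codimension at most 2 is automatically a Lie bracket.  Indeed, if [e1]
    and [e2] span [V] modulo [C], then [b x y = omega x y *: w], where [omega]
    is the 2 x 2 determinant of the coordinates of [x] and [y] along [e1] and
    [e2], and [w = b e1 e2].  The Jacobi sum is then the multiple of [w] by
    [omega y z * omega x w + omega z x * omega y w + omega x y * omega z w],
    which vanishes by the Pluecker relation for 2 x 2 determinants.  Put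
    differently, the Jacobi sum is an alternating trilinear map on [V / C],
    whose dimension is less than 3.  This is [codim2_is_lie_bracket].

    The sum of the two given brackets is bilinear, alternating and killed by
    the common center, whose codimension is at most 2; this gives
    compatibility. *)

Lemma codim2_coordinates {k : fieldType} {V : vectType k} {C : {vspace V}} :
  (\dim {:V} <= \dim C + 2)%N ->
  exists e1 e2 : V, forall x, exists a1 a2 : k, exists2 c : V,
    c \in C & x = a1 *: e1 + (a2 *: e2 + c).
Proof.
move=> dimC; set X := vbasis C^C.
have sizeX : (size X <= 2)%N by rewrite size_tuple dimv_compl leq_subLR.
(* The default value 0 stands for the basis vectors that are missing when the
   codimension is less than 2. *)
exists X`_0, X`_1 => x.
have subX : (C^C <= <[X`_0]> + <[X`_1]>)%VS.
  have defC := span_basis (vbasisP C^C).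
  rewrite -[X in (X <= _)%VS]defC; apply/span_subvP => v.
  case/(nthP 0) => -[|[|i]] ltiX <-.
  - exact: subvP (addvSl _ _) _ (memv_line _).
  - exact: subvP (addvSr _ _) _ (memv_line _).
  - by have := leq_trans ltiX sizeX.
have: x \in (C + C^C)%VS by rewrite addv_complf memvf.
case/memv_addP => c cC [d /(subvP subX)].
case/memv_addP => _ /vlineP[a1 ->] [_ /vlineP[a2 ->] ->] ->.
by exists a1, a2, c => //; rewrite addrC addrA.
Qed.

Lemma alternating_antisym {k : fieldType} {V : vectType k} {b : V -> V -> V} :
  (forall y, linear (b^~ y)) -> (forall x, linear (b x)) ->
  (forall x, b x x = 0) -> forall x y, b y x = - b x y.
Proof.
move=> bl br b0 x y; apply/eqP; rewrite -addr_eq0 addrC; apply/eqP.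
have := b0 (1 *: x + y).
by rewrite bl !br !b0 !scale1r add0r addr0.
Qed.

(** Modulo [C] only the terms in [e1] and [e2] survive, and antisymmetry combines
    the two mixed ones into a determinant. *)
Lemma bracket_eq_det {k : fieldType} {V : vectType k} {b : V -> V -> V}
    {C : {vspace V}} (e1 e2 : V) (a1 a2 a1' a2' : k) (c c' : V) :
  (forall y, linear (b^~ y)) -> (forall x, linear (b x)) ->
  (forall x, b x x = 0) -> (forall c y, c \in C -> b c y = 0) ->
  c \in C -> c' \in C ->
  b (a1 *: e1 + (a2 *: e2 + c)) (a1' *: e1 + (a2' *: e2 + c')) =
    (a1 * a2' - a2 * a1') *: b e1 e2.
Proof.
move=> bl br b0 bC cC c'C.
have bC' x : b x c' = 0.
  by rewrite (alternating_antisym bl br b0 c' x) bC ?oppr0.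
rewrite !bl !br !(bC c) // !bC' !b0 (alternating_antisym bl br b0 e1 e2).
by rewrite !scaler0 !addr0 add0r !scalerN !scalerA scalerBl.
Qed.

(** All values of [b] are proportional to one vector, so the Jacobi identity
    becomes a polynomial identity between coordinates. *)
Lemma codim2_is_lie_bracket {k : fieldType} {V : vectType k}
    {b : V -> V -> V} {C : {vspace V}} :
  (\dim {:V} <= \dim C + 2)%N ->
  (forall y, linear (b^~ y)) -> (forall x, linear (b x)) ->
  (forall x, b x x = 0) -> (forall c y, c \in C -> b c y = 0) ->
  is_lie_bracket b.
Proof.
move=> dimC bl br b0 bC; split=> // x y z.
have [e1 [e2 coords]] := codim2_coordinates dimC.
have bZ u a v : b u (a *: v) = a *: b u v.
  have bu0 : b u 0 = 0.
    by have := br u (-1) 0 0; rewrite scaler0 addr0 scaleN1r addNr.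
  by rewrite -[a *: v]addr0 br bu0 addr0.
have [x1 [x2 [cx cxC ->]]] := coords x.
have [y1 [y2 [cy cyC ->]]] := coords y.
have [z1 [z2 [cz czC ->]]] := coords z.
rewrite !(bracket_eq_det (C := C)) // !bZ.
(* The value [b e1 e2] must itself be expanded once as an argument of [b]; its
   other occurrences stay as the common factor [w]. *)
have [w1 [w2 [cw cwC]]] := coords (b e1 e2).
set w := b e1 e2 => Ew.
have bw a1 a2 c : c \in C ->
    b (a1 *: e1 + (a2 *: e2 + c)) w = (a1 * w2 - a2 * w1) *: w.
  by move=> cC; rewrite Ew (bracket_eq_det (C := C)) // -/w -Ew.
rewrite !bw // !scalerA -!scalerDl -[RHS](scale0r w).
by congr (_ *: _); ring.
Qed.

Theorem lemma6p7 (k : fieldType) (char0 : [pchar k] =i pred0)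
    (n : nat) (V : vectType k) (hV : \dim {:V} = n)
    (gd gt : lie_structure V) (hd : is_dyon n gd) (ht : is_triadon n gt)
    (hC : \dim (center gd :&: center gt) = (n - 2)%N) :
  compatible gd gt.
Proof.
have [dl dr d0 _] := bracketP gd; have [tl tr t0 _] := bracketP gt.
apply: (codim2_is_lie_bracket (C := (center gd :&: center gt)%VS)).
- by rewrite hC hV addnC -leq_subLR.
- by move=> y a u v; rewrite /= dl tl scalerDr addrACA.
- by move=> x a u v; rewrite dr tr scalerDr addrACA.
- by move=> x; rewrite d0 t0 addr0.
- by move=> c y; rewrite memv_cap => /andP[/mem_center -> /mem_center ->];
    rewrite addr0.
Qed.
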